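(* Let $X$ be a diffeological space. The identity map $\mathrm{id}:\mathfrak{P}^\star_{lp}(X)\rightarrow \mathfrak{P}^\star_{u}(X)$ is smooth; namely, the locally projectable diffeology is finer than (i.e. contained in) the union power set diffeology.
   Context: A parametrization in a set $X$ is a map $P:U\to X$ with $U$ an open subset of some $\mathbb{R}^n$. A diffeology on $X$ is a set of parametrizations in $X$ (called plots) that contains all constant parametrizations, is local, and is stable under precomposition with smooth maps between open subsets of Euclidean spaces. A map $f$ between diffeological spaces is smooth if $f\circ P$ is a plot for every plot $P$. Subsets carry the subset diffeology. The diffeology generated by a set of parametrizations containing the constants is the set of parametrizations that are locally of the form $Q\circ F$ with $Q$ in the set and $F$ a smooth map between open subsets of Euclidean spaces. $C^\infty(A,X)$ is the set of smooth maps $A\to X$ with the functional diffeology: $Q:V\to C^\infty(A,X)$ is a plot iff for every plot $P:U\to A$ the map $(r,s)\mapsto Q(r)(P(s))$ on $V\times U$ is a plot of $X$. $\mathfrak{P}^\star(X)$ is the set of nonempty subsets of $X$. For $A\in\mathfrak{P}^\star(X)$ (with the subset diffeology) and $U$ a nonempty open subset of a Euclidean space, a local projectable parametrization at $A$ with domain $U$ is a map $\phi:U\to\mathfrak{P}^\star(X)$ for which there exists a smooth map $\varphi:U\to C^\infty(A,X)$ such that $\varphi(r_0)=\mathrm{id}_A$ (i.e. $\varphi(r_0)$ is the inclusion of $A$) for some $r_0\in U$, and $\phi(r)=\varphi(r)(A)$ for all $r\in U$. The locally projectable diffeology is the diffeology on $\mathfrak{P}^\star(X)$ generated by all local projectable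 parametrizations at all $A\in\mathfrak{P}^\star(X)$; the resulting space is $\mathfrak{P}^\star_{lp}(X)$. Union power set diffeology on the set $\mathfrak{P}(X)$ of all subsets: $P:U\to\mathfrak{P}(X)$ is a plot iff there is a family of parametrizations $P_i:U_i\to\mathfrak{P}(X)$ ($i\in J$, $U_i$ open in the same Euclidean space, $U=\bigcup_i U_i$), each either constant with value $\emptyset$ or of the form $r\mapsto\{p_i(r)\}$ for a plot $p_i:U_i\to X$, such that $P(r)=\bigcup\{P_i(r)\mid i\in J,\ r\in U_i\}$ for all $r\in U$. Equivalently: for every $r_0\in U$ and $x_0\in P(r_0)$ there exist an open neighborhood $V\subset U$ of $r_0$ and a plot $\sigma:V\to X$ with $\sigma(r)\in P(r)$ for all $r\in V$ and $\sigma(r_0)=x_0$. $\mathfrak{P}^\star_u(X)$ is $\mathfrak{P}^\star(X)$ with the corresponding subset diffeology. *)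

(* Defs.v *)
From mathcomp Require Import all_boot all_order all_algebra.
From mathcomp Require Import all_classical.
From mathcomp Require Import reals topology normedtype landau derive.

Set Implicit Arguments.
Unset Strict Implicit.
Unset Printing Implicit Defensive.

Import Order.TTheory GRing.Theory Num.Theory.
Import numFieldNormedType.Exports.

Local Open Scope classical_set_scope.
Local Open Scope ring_scope.

Section Ck.
Variable R : realType.

(* Real functions of class C^k on U, meant for U open.  Functions are total, but
   by [Ck_eq] only the values on U matter.  Differentiability together with the
   C^(k-1) condition on the partial derivatives is the usual notion: continuous
   partial derivatives entail differentiability. *)
Fixpoint Ck (k : nat) n (U : set 'rV[R]_n) (f : 'rV[R]_n -> R) : Prop :=
  if k is k'.+1 then
    (forall x, U x -> differentiable f x) /\
    (forall i, Ck k' U ('D_(delta_mx 0 i) f))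
  else forall x, U x -> {for x, continuous f}.

Lemma near_eq_differentiable n (f g : 'rV[R]_n -> R) x :
  (\near x, f x = g x) -> differentiable f x -> differentiable g x.
Proof.
move=> fg df; pose h y := g y - f y.
have -> : g = f + h by rewrite funeqE => y; rewrite /= addrC subrK.
apply: differentiableD => //.
have hx : h x = 0 by rewrite /h (nbhs_singleton fg) subrr.
have hE : h \o shift x = cst (h x) + (\0 : {linear 'rV[R]_n -> R}) +o_ 0 id.
  apply/eqaddoP => e e0.
  suff : \forall y \near 0, h (y + x) = 0.
    apply: filterS => y; rewrite /= !fctE /= => ->.
    by rewrite hx addr0 subrr normr0 mulr_ge0 ?normr_ge0 1?ltW.
  have : \forall y \near x, h y = 0.
    by apply: filterS fg => y; rewrite /h => ->; rewrite subrr.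
  by rewrite (near_shift 0) subr0.
have c0 : continuous (\0 : {linear 'rV[R]_n -> R}) by exact: cst_continuous.
by apply/diff_locallyP; rewrite (diff_unique c0 hE).
Qed.

Lemma Ck_sub k n (U V : set 'rV[R]_n) f : V `<=` U -> Ck k U f -> Ck k V f.
Proof.
move=> VU; elim: k f => [|k IH] f /=; first by move=> cf x /VU /cf.
by case=> df Df; split=> [x /VU /df//|i]; exact: IH.
Qed.

Lemma Ck_local k n (U : set 'rV[R]_n) f :
  (forall x, U x -> exists2 V, V x & Ck k V f) -> Ck k U f.
Proof.
elim: k f => [|k IH] f /= H.
  by move=> x /H [V Vx]; apply.
split=> [x /H [V Vx [dV _]]|i]; first exact: dV.
by apply: IH => x /H [V Vx [_ DV]]; exists V.
Qed.

Lemma open_near_eq n (U : set 'rV[R]_n) (f g : 'rV[R]_n -> R) x :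
  open U -> U x -> (forall y, U y -> f y = g y) -> {near x, f =1 g}.
Proof. by move=> oU Ux e; apply: filterS (open_nbhs_nbhs (conj oU Ux)). Qed.

Lemma Ck_eq k n (U : set 'rV[R]_n) f g : open U ->
  (forall x, U x -> f x = g x) -> Ck k U f -> Ck k U g.
Proof.
move=> oU; elim: k f g => [|k IH] f g e.
  move=> cf x Ux; rewrite /prop_for /continuous_at -(e _ Ux).
  apply: cvg_trans (cf x Ux); apply: (@near_eq_cvg _ _ (nbhs x)).
  exact: open_near_eq oU Ux e.
case=> df Df; split=> [x Ux|i].
  by apply: near_eq_differentiable (df x Ux); exact: open_near_eq oU Ux e.
apply: IH (Df i) => x Ux; apply: near_eq_derive; exact: open_near_eq oU Ux e.
Qed.

Lemma CkW k n (U : set 'rV[R]_n) f : Ck k.+1 U f -> Ck k U f.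
Proof.
elim: k f => [|k IH] f [df Df].
  by move=> x /df; exact: differentiable_continuous.
by split=> // i; exact: IH.
Qed.

Lemma Ck_cst k n (U : set 'rV[R]_n) (c : R) : Ck k U (cst c).
Proof.
elim: k c => [|k IH] c /=; first by move=> x _; exact: cst_continuous.
split=> [x _|i]; first exact: differentiable_cst.
have -> : 'D_(delta_mx 0 i) (cst c : 'rV[R]_n -> R) = cst 0; last exact: IH.
by rewrite funeqE => x; rewrite derive_cst.
Qed.

Lemma CkD k n (U : set 'rV[R]_n) f g : open U ->
  Ck k U f -> Ck k U g -> Ck k U (fun x => f x + g x).
Proof.
move=> oU; elim: k f g => [|k IH] f g /=.
  by move=> cf cg x Ux; exact: continuousD (cf x Ux) (cg x Ux).
move=> [df Df] [dg Dg]; split=> [x Ux|i].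
  by apply: differentiableD; [exact: df|exact: dg].
apply: Ck_eq (IH _ _ (Df i) (Dg i)) => // x Ux.
by rewrite -deriveD//; apply: diff_derivable; [exact: df|exact: dg].
Qed.

Lemma CkM k n (U : set 'rV[R]_n) f g : open U ->
  Ck k U f -> Ck k U g -> Ck k U (fun x => f x * g x).
Proof.
move=> oU; elim: k f g => [|k IH] f g.
  by move=> cf cg x Ux; exact: continuousM (cf x Ux) (cg x Ux).
move=> Cf Cg; have [df Df] := Cf; have [dg Dg] := Cg.
split=> [x Ux|i].
  by apply: differentiableM; [exact: df|exact: dg].
apply: Ck_eq (CkD oU (IH _ _ (CkW Cf) (Dg i)) (IH _ _ (CkW Cg) (Df i))) => //.
move=> x Ux.
rewrite (@deriveM _ _ f g x); first by [].
- by apply: diff_derivable; exact: df.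
- by apply: diff_derivable; exact: dg.
Qed.

Lemma Ck_sum k n (U : set 'rV[R]_n) m (F : 'I_m -> 'rV[R]_n -> R) : open U ->
  (forall i, Ck k U (F i)) -> Ck k U (fun x => \sum_i F i x).
Proof.
move=> oU CF; elim: (index_enum _) => [|j s IH].
  by apply: Ck_eq (Ck_cst k U 0) => // x _; rewrite big_nil.
by apply: Ck_eq (CkD oU (CF j) IH) => // x _; rewrite big_cons.
Qed.

Lemma Ck_coord k n (U : set 'rV[R]_n) j : Ck k U (fun x => x 0 j).
Proof.
case: k => [|k] /=.
  by move=> x _; exact: coord_continuous.
split=> [x _|i]; first exact: differentiable_coord.
suff -> : 'D_(delta_mx 0 i) (fun x : 'rV[R]_n => x 0 j) = cst ((i == j)%:R).
  exact: Ck_cst.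
rewrite funeqE => x; have := derive_mx (@derivable_id _ _ x (delta_mx 0 i)).
move=> /matrixP /(_ 0 j); rewrite mxE => <-; rewrite derive_id mxE eqxx.
by rewrite eq_sym.
Qed.

Lemma differentiable_rV n m (f : 'rV[R]_n -> 'rV[R]_m) x :
  (forall j, differentiable (fun y => f y 0 j) x) -> differentiable f x.
Proof.
move=> df.
have -> : f = \sum_j (fun y => f y 0 j *: (delta_mx 0 j : 'rV[R]_m)).
  by rewrite funeqE => y; rewrite {1}(row_sum_delta (f y)) fct_sumE.
by apply: differentiable_sum => j; exact: differentiableZl.
Qed.

Lemma continuous_rV n m (f : 'rV[R]_n -> 'rV[R]_m) x :
  (forall j, {for x, continuous (fun y => f y 0 j)}) -> {for x, continuous f}.
Proof.
move=> cf A [Q Qx QA].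
suff : \forall y \near x, forall i j, Q i j (f y i j).
  by apply: filterS => y Qy; exact: QA.
apply: (@filter_forall _ _ (fun i y => forall j, Q i j (f y i j)) (nbhs x) _) => i.
apply: (@filter_forall _ _ (fun j y => Q i j (f y i j)) (nbhs x) _) => j.
by have := Qx i j; rewrite (ord1 i); exact: cf.
Qed.

Lemma Ck_comp k n m (U : set 'rV[R]_n) (V : set 'rV[R]_m)
    (f : 'rV[R]_n -> 'rV[R]_m) g : open U ->
  (forall x, U x -> V (f x)) ->
  (forall j, Ck k U (fun x => f x 0 j)) -> Ck k V g -> Ck k U (g \o f).
Proof.
move=> oU fUV; elim: k g => [|k IH] g.
  move=> cf cg x Ux; apply: continuous_comp; last exact: (cg _ (fUV _ Ux)).
  by apply: continuous_rV => j; exact: (cf j).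
move=> Cf [dg Dg]; have df x : U x -> differentiable f x.
  by move=> Ux; apply: differentiable_rV => j; have [+ _] := Cf j; exact.
split=> [x Ux|i].
  by apply: differentiable_comp; [exact: df|exact/dg/fUV].
have := @Ck_sum k _ _ m (fun j x => 'D_(delta_mx 0 i) (fun x => f x 0 j) x *
   'D_(delta_mx 0 j) g (f x)) oU.
move=> /(_ (fun j => CkM oU ((Cf j).2 i) (IH _ (fun j => CkW (Cf j)) (Dg j)))).
apply: Ck_eq => // x Ux.
have dfx := df _ Ux; have dgx := dg _ (fUV _ Ux).
have fx : 'd f x (delta_mx 0 i) =
    \sum_j 'D_(delta_mx 0 i) (fun y => f y 0 j) x *: delta_mx 0 j.
  rewrite -deriveE// derive_mx; last exact: diff_derivable.
  by rewrite [LHS]row_sum_delta; apply: eq_bigr => j _; rewrite mxE.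
rewrite [RHS]deriveE; last exact: differentiable_comp.
rewrite diff_comp//= fx linear_sum; apply: eq_bigr => j _.
by rewrite linearZ /= (deriveE _ dgx).
Qed.

End Ck.
Definition set_incl T (A B : set T) (AB : A `<=` B) (x : A) : B :=
  SigSub (mem_set (AB _ (set_mem (valP x)))).

Section SmoothMap.
Variable R : realType.

(* The library differentiates functions defined on the whole space, hence the
   total extension f of F, of which only the restriction to V is constrained.
   All dimensions, including 0, are allowed. *)
Definition smooth_map m n (V : set 'rV[R]_m) (U : set 'rV[R]_n) (F : V -> U) :=
  exists2 f : 'rV[R]_m -> 'rV[R]_n,
    (forall j k, Ck k V (fun x => f x 0 j)) &
    (forall x : V, val (F x) = f (val x)).

Lemma smooth_map_comp m n p (W : set 'rV[R]_m) (V : set 'rV[R]_n)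
    (U : set 'rV[R]_p) (F : W -> V) (G : V -> U) :
  open W -> smooth_map F -> smooth_map G -> smooth_map (G \o F).
Proof.
move=> oW [f Cf Ff] [g Cg Gg]; exists (g \o f) => [j k|x /=].
  apply: (@Ck_comp _ k _ _ W V f (fun x => g x 0 j)) => // x Wx.
  by rewrite -(Ff (SigSub (mem_set Wx))); exact: set_mem (valP _).
by rewrite Gg Ff.
Qed.

Lemma smooth_map_incl n (V U : set 'rV[R]_n) (VU : V `<=` U) :
  smooth_map (set_incl VU).
Proof. by exists id => [j k|x //]; exact: Ck_coord. Qed.

Lemma smooth_map_cst m n (V : set 'rV[R]_m) (U : set 'rV[R]_n) (x : U) :
  smooth_map (fun _ : V => x).
Proof. by exists (cst (val x)) => // j k; exact: Ck_cst. Qed.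

Lemma smooth_map_local m n (V : set 'rV[R]_m) (U : set 'rV[R]_n) (F : V -> U) :
    (forall r : V, exists (W : set 'rV[R]_m) (WV : W `<=` V),
      [/\ W (val r), open W & smooth_map (F \o set_incl WV)]) ->
  smooth_map F.
Proof.
move=> H.
pose f x := if pselect (V x) is left Vx then val (F (SigSub (mem_set Vx))) else 0.
have fE (x : V) : val (F x) = f (val x).
  rewrite /f; case: pselect => [Vx|]; last by have := set_mem (valP x).
  by congr (val (F _)); exact: val_inj.
exists f => // j k; apply: Ck_local => x Vx.
have [W [WV [Wx oW [g Cg gE]]]] := H (SigSub (mem_set Vx)).
exists W => //; apply: Ck_eq (Cg j k) => // y Wy.
by have := gE (SigSub (mem_set Wy)); rewrite /= fE /= => ->.
Qed.

Lemma smooth_map_preimage m n (D : set 'rV[R]_m) (U V : set 'rV[R]_n)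
    (F : D -> U) : open D -> open V -> V `<=` U -> smooth_map F ->
  exists (D' : set 'rV[R]_m) (D'D : D' `<=` D) (F' : D' -> V),
    [/\ open D', (forall x : D, V (val (F x)) -> D' (val x)), smooth_map F' &
      forall x, val (F' x) = val (F (set_incl D'D x))].
Proof.
move=> oD oV VU [f Cf Ff]; pose D' := D `&` f @^-1` V.
have D'D : D' `<=` D by move=> ? [].
have F'V (x : D') : f (val x) \in V by have [] := set_mem (valP x); rewrite inE.
exists D', D'D, (fun x => SigSub (F'V x)); split.
- have fc x : D x -> {for x, continuous f}.
    by move=> Dx; apply: continuous_rV => j; exact: (Cf j 0%N).
  rewrite openE => x [Dx Vfx]; apply: filterI.
    exact: open_nbhs_nbhs.
  by apply: fc => //; exact: open_nbhs_nbhs.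
- by move=> x; rewrite Ff => Vx; split=> //; exact: set_mem (valP x).
- by exists f => // j k; exact: Ck_sub (Cf j k).
- by move=> x; rewrite Ff.
Qed.

(* The open set V x U of R^m x R^n, seen in R^(m+n). *)
Definition prod_dom m n (V : set 'rV[R]_m) (U : set 'rV[R]_n) :
  set 'rV[R]_(m + n) := [set z | V (lsubmx z) /\ U (rsubmx z)].

Definition prod_fst m n (V : set 'rV[R]_m) (U : set 'rV[R]_n)
  (z : prod_dom V U) : V := SigSub (mem_set (set_mem (valP z)).1).

Definition prod_snd m n (V : set 'rV[R]_m) (U : set 'rV[R]_n)
  (z : prod_dom V U) : U := SigSub (mem_set (set_mem (valP z)).2).

Lemma open_prod_dom m n (V : set 'rV[R]_m) (U : set 'rV[R]_n) :
  open V -> open U -> open (prod_dom V U).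
Proof.
move=> oV oU; apply: openI.
  by apply: open_comp oV => x _; exact: continuous_lsubmx.
by apply: open_comp oU => x _; exact: continuous_rsubmx.
Qed.

Lemma smooth_prod_fst m n (V : set 'rV[R]_m) (U : set 'rV[R]_n) :
  smooth_map (@prod_fst m n V U).
Proof.
exists lsubmx => // j k.
have -> : (fun x : 'rV[R]_(m + n) => lsubmx x 0 j) = fun x => x 0 (lshift n j).
  by rewrite funeqE => x; rewrite mxE.
exact: Ck_coord.
Qed.

Lemma smooth_prod_snd m n (V : set 'rV[R]_m) (U : set 'rV[R]_n) :
  smooth_map (@prod_snd m n V U).
Proof.
exists rsubmx => // j k.
have -> : (fun x : 'rV[R]_(m + n) => rsubmx x 0 j) = fun x => x 0 (rshift m j).
  by rewrite funeqE => x; rewrite mxE.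
exact: Ck_coord.
Qed.

Lemma smooth_prod_pair p m n (W : set 'rV[R]_p) (V : set 'rV[R]_m)
    (U : set 'rV[R]_n) (F : W -> V) (G : W -> U) :
  smooth_map F -> smooth_map G ->
  exists H : W -> prod_dom V U, [/\ smooth_map H,
    forall x, prod_fst (H x) = F x & forall x, prod_snd (H x) = G x].
Proof.
move=> [f Cf Ff] [g Cg Gg].
have HP (x : W) : row_mx (f (val x)) (g (val x)) \in prod_dom V U.
  by rewrite inE; split; rewrite ?row_mxKl ?row_mxKr -?Ff -?Gg;
    exact: set_mem (valP _).
exists (fun x => SigSub (HP x)); split.
- exists (fun x => row_mx (f x) (g x)) => // j k.
  have -> : (fun x => row_mx (f x) (g x) 0 j) =
      fun x => match fintype.split j with inl i => f x 0 i | inr i => g x 0 i end.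
    by rewrite funeqE => x; rewrite mxE.
  by case: (fintype.split j) => i.
- by move=> x; apply: val_inj; rewrite /= row_mxKl Ff.
- by move=> x; apply: val_inj; rewrite /= row_mxKr Gg.
Qed.

End SmoothMap.

(* A parametrization with domain U is a function on the subtype of the points of
   U; U may be empty.  [plot] is the set of plots, and [plot_open] says that
   they are parametrizations, i.e., that their domains are open. *)
Record diffSpace (R : realType) := DiffSpace {
  carrier :> Type;
  plot : forall n (U : set 'rV[R]_n), set (U -> carrier);
  plot_open : forall n (U : set 'rV[R]_n) (P : U -> carrier),
    plot P -> open U;
  plot_cst : forall n (U : set 'rV[R]_n) (x : carrier),
    open U -> plot (fun _ : U => x);
  plot_local : forall n (U : set 'rV[R]_n) (P : U -> carrier), open U ->
    (forall r : U, exists (V : set 'rV[R]_n) (VU : V `<=` U),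
      [/\ V (val r), open V & plot (P \o set_incl VU)]) -> plot P;
  plot_comp : forall m n (V : set 'rV[R]_m) (U : set 'rV[R]_n)
      (P : U -> carrier) (F : V -> U),
    open V -> smooth_map F -> plot P -> plot (P \o F)
}.
Arguments plot {R} d {n U}.

Definition Pstar (T : Type) : set (set T) := [set A | A !=set0].
Arguments Pstar : clear implicits.

Section Diffeology.
Variable R : realType.
Implicit Types X Y : diffSpace R.

Definition smooth X Y (f : X -> Y) := forall n (U : set 'rV[R]_n) (P : U -> X),
  plot X P -> plot Y (f \o P).

(* Subsets of R^n, with the diffeology of the smooth parametrizations. *)
Section Domain.
Variables (n : nat) (U : set 'rV[R]_n).

Definition domain_plot m (V : set 'rV[R]_m) : set (V -> U) :=
  [set P | open V /\ smooth_map P].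

Program Definition domain := @DiffSpace R U domain_plot _ _ _ _.
Next Obligation. by move=> m V P []. Qed.
Next Obligation. by move=> m V x oV; split=> //; exact: smooth_map_cst. Qed.
Next Obligation.
move=> m V P oV H; split=> //; apply: smooth_map_local => r.
by have [W [WV [Wr oW [_ sP]]]] := H r; exists W, WV.
Qed.
Next Obligation.
by move=> m p V W P F oV sF [oW sP]; split=> //; exact: smooth_map_comp.
Qed.

End Domain.

Section Subspace.
Variables (X : diffSpace R) (A : set X).

Definition subspace_plot n (U : set 'rV[R]_n) : set (U -> A) :=
  [set P | plot X (fun r => val (P r))].

Program Definition subSpace := @DiffSpace R A subspace_plot _ _ _ _.
Next Obligation. by move=> n U P /plot_open. Qed.
Next Obligation. by move=> n U x oU; exact: plot_cst. Qed.
Next Obligation. by move=> n U P oU H; exact: plot_local. Qed.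
Next Obligation. by move=> m n V U P F oV sF pP; exact: plot_comp sF pP. Qed.

End Subspace.

Section Functional.
Variables A X : diffSpace R.

Definition smoothFun := {f : A -> X | smooth f}.

Definition functional_plot m (V : set 'rV[R]_m) : set (V -> smoothFun) :=
  [set Q | open V /\ forall n (U : set 'rV[R]_n) (P : U -> A), plot A P ->
     plot X (fun z : prod_dom V U =>
       proj1_sig (Q (prod_fst z)) (P (prod_snd z)))].

Program Definition funSpace := @DiffSpace R smoothFun functional_plot _ _ _ _.
Next Obligation. by move=> m V Q []. Qed.
Next Obligation.
move=> m V f oV; split=> // n U P pP.
have oVU := open_prod_dom oV (plot_open pP).
exact: plot_comp oVU (@smooth_prod_snd _ _ _ V U) (proj2_sig f _ _ _ pP).
Qed.
Next Obligation.
move=> m V Q oV H; split=> // n U P pP.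
have oU := plot_open pP.
apply: plot_local => [|r]; first exact: open_prod_dom.
have [W [WV [Wr oW [_ /(_ _ _ _ pP) pQ]]]] := H (prod_fst r).
have sub : prod_dom W U `<=` prod_dom V U by move=> z [/WV].
exists (prod_dom W U), sub; split.
- by split=> //; exact: (set_mem (valP r)).2.
- exact: open_prod_dom.
- congr (plot X _): pQ; rewrite funeqE => z /=.
  by congr (proj1_sig (Q _) (P _)); exact: val_inj.
Qed.
Next Obligation.
move=> p m W V Q F oW sF [oV H]; split=> // n U P pP.
have oWU := open_prod_dom oW (plot_open pP).
have [G [sG G1 G2]] := smooth_prod_pair
  (smooth_map_comp oWU (@smooth_prod_fst _ _ _ W U) sF)
  (@smooth_prod_snd _ _ _ W U).
have := plot_comp oWU sG (H _ _ _ pP); congr (plot X _).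
by rewrite funeqE => z /=; rewrite G1 G2.
Qed.

End Functional.

Section Generated.
Variables (T : Type) (G : forall n (U : set 'rV[R]_n), set (U -> T)).
(* A constant with empty domain is locally of the form Q \o F anyway, so the
   generating set need not contain it. *)
Hypothesis G_cst : forall n (U : set 'rV[R]_n) x,
  open U -> U !=set0 -> G (fun _ : U => x).

Definition generated_plot n (U : set 'rV[R]_n) : set (U -> T) :=
  [set P : U -> T | open U /\ forall r : U,
    exists (V : set 'rV[R]_n) (VU : V `<=` U), [/\ V (val r), open V &
      exists m (W : set 'rV[R]_m) (Q : W -> T) (F : V -> W),
      [/\ open W, G Q, smooth_map F & P \o set_incl VU =1 Q \o F]]].

Program Definition generated := @DiffSpace R T generated_plot _ _ _ _.
Next Obligation. by move=> n U P []. Qed.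
Next Obligation.
move=> n U x oU; split=> // r; exists U, (@subset_refl _ U).
have Ur := set_mem (valP r).
split=> //; exists n, U, (fun=> x), id.
split=> //; first by apply: G_cst => //; exists (val r).
by exists id => // j k; exact: Ck_coord.
Qed.
Next Obligation.
move=> n U P oU H; split=> // r.
have [V [VU [Vr oV [_ /(_ (SigSub (mem_set Vr)))]]]] := H r.
move=> [W [WV [Wr oW [m [D [Q [F [oD GQ sF PQ]]]]]]]].
exists W, (subset_trans WV VU); split=> //.
exists m, D, Q, F; split=> // x.
by rewrite -(PQ x) /=; congr P; exact: val_inj.
Qed.
Next Obligation.
move=> m n V U P F oV sF [oU H]; split=> // r.
have [W [WU [Wr oW [p [D [Q [K [oD GQ sK PQ]]]]]]]] := H (F r).
have [V' [V'V [F' [oV' V'P sF' F'E]]]] := smooth_map_preimage oV oW WU sF.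
exists V', V'V; split=> //; first exact: V'P.
exists p, D, Q, (K \o F'); split=> //; first exact: smooth_map_comp.
by move=> x; rewrite /= -[RHS]PQ /=; congr P; apply: val_inj; rewrite /= F'E.
Qed.

End Generated.

Section PowerSet.
Variable X : diffSpace R.

(* The union power set diffeology; [union_plotP] below is its pointwise
   characterization. *)
Definition union_plot n (U : set 'rV[R]_n) : set (U -> set X) := [set P |
  exists (J : Type) (U_ : J -> set 'rV[R]_n) (P_ : forall i, U_ i -> set X),
  [/\ forall i, open (U_ i),
      forall i, (forall r, P_ i r = set0) \/
        (exists2 p : U_ i -> X, plot X p & forall r, P_ i r = [set p r]),
      U = \bigcup_i U_ i &
      forall r : U, P r =
        [set x | exists i (s : U_ i), val s = val r /\ P_ i s x]]].

Lemma union_plotP n (U : set 'rV[R]_n) (P : U -> set X) :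
  union_plot P <-> open U /\ forall (r0 : U) x0, P r0 x0 ->
    exists (V : set 'rV[R]_n) (VU : V `<=` U) (sigma : V -> X),
      [/\ V (val r0), plot X sigma,
          (forall r, P (set_incl VU r) (sigma r)) &
          (forall r, val r = val r0 -> sigma r = x0)].
Proof.
split=> [[J [U_ [P_ [oU_ HP UE PE]]]]|[oU H]].
  split; first by rewrite UE; exact: bigcup_open.
  move=> r0 x0; rewrite PE /= => -[i [s [sr Px]]].
  have UiU : U_ i `<=` U by rewrite UE => x Ux; exists i.
  case: (HP i) => [P0|[p pp pE]]; first by rewrite P0 in Px.
  exists (U_ i), UiU, p; split=> //.
  - by rewrite -sr; exact: set_mem (valP s).
  - by move=> r; rewrite PE /=; exists i, r; rewrite pE.
  - move=> r rr0; have -> : r = s by apply: val_inj; exact: etrans rr0 (esym sr).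
    by move: Px; rewrite pE => ->.
pose L := {V : set 'rV[R]_n & {sigma : V -> X | plot X sigma /\
  exists VU : V `<=` U, forall r, P (set_incl VU r) (sigma r)}}.
pose U_ (j : option L) := if j is Some l then projT1 l else U.
pose P_ (j : option L) : U_ j -> set X :=
  match j with
  | Some l => fun r : projT1 l => [set proj1_sig (projT2 l) r]
  | None => fun _ => set0
  end.
exists (option L), U_, P_; split.
- by case=> [[V [sigma [ps ?]]]|] //=; exact: plot_open ps.
- by case=> [[V [sigma [ps ?]]]|]; [right; exists sigma|left].
- rewrite eqEsubset; split=> x; first by move=> Ux; exists None.
  by case=> -[[V [sigma [? [VU ?]]]]|] _ //=; exact: VU.
- move=> r; rewrite eqEsubset; split=> [x Px|x [[[V [s [ps [VU sP]]]]|]]] /=.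
  + have [V [VU [s [Vr ps sP sx]]]] := H _ _ Px.
    have sig : plot X s /\ exists VU : V `<=` U,
      forall r, P (set_incl VU r) (s r) by split=> //; exists VU.
    exists (Some (existT _ V (exist _ s sig))), (SigSub (mem_set Vr)).
    by split=> //=; rewrite sx.
  + move=> [v [vr ->]]; have := sP v.
    by congr (P _ _); exact: val_inj.
  + by move=> [? []].
Qed.

Program Definition powerSpace := @DiffSpace R (set X) union_plot _ _ _ _.
Next Obligation. by move=> n U P /union_plotP []. Qed.
Next Obligation.
move=> n U A oU; apply/union_plotP; split=> // r0 x0 Ax.
exists U, (@subset_refl _ U), (fun=> x0); split=> //.
- exact: set_mem (valP r0).
- exact: plot_cst.
Qed.
Next Obligation.
move=> n U P oU H; apply/union_plotP; split=> // r0 x0 Px.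
have [V [VU [Vr oV /union_plotP[_ HV]]]] := H r0.
have /HV : (P \o set_incl VU) (SigSub (mem_set Vr)) x0.
  by move: Px => /=; congr (P _ _); exact: val_inj.
move=> [W [WV [s [Wr ps sP sx]]]].
exists W, (subset_trans WV VU), s; split=> // r.
by have := sP r; congr (P _ _); exact: val_inj.
Qed.
Next Obligation.
move=> m n V U P F oV sF /union_plotP[oU H]; apply/union_plotP; split=> // r0 x0.
move=> /H [W [WU [s [Wr ps sP sx]]]].
have [V' [V'V [F' [oV' V'P sF' F'E]]]] :=
  smooth_map_preimage oV (plot_open ps) WU sF.
exists V', V'V, (s \o F'); split.
- exact: V'P.
- exact: plot_comp sF' ps.
- move=> r; have := sP (F' r); congr (P _ _).
  by apply: val_inj; rewrite /= F'E.
- move=> r rr0; apply: sx; rewrite F'E; congr (val (F _)).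
  exact: val_inj.
Qed.

Definition Pstar_u := @subSpace powerSpace (Pstar X).

(* The domain U carries its standard diffeology, A the subset diffeology, and
   the set of smooth maps from A to X the functional diffeology. *)
Definition local_projectable (A : Pstar X) n (U : set 'rV[R]_n) :
    set (U -> Pstar X) :=
  [set phi | [/\ open U, U !=set0 &
    exists varphi : domain U -> funSpace (@subSpace X (val A)) X,
      [/\ smooth varphi,
          exists r0, forall a, proj1_sig (varphi r0) a = val a &
          forall r, val (phi r) = range (proj1_sig (varphi r))]]].

Definition lp_params n (U : set 'rV[R]_n) : set (U -> Pstar X) :=
  [set phi | exists A : Pstar X, local_projectable A phi].

Lemma lp_params_cst n (U : set 'rV[R]_n) (A : Pstar X) :
  open U -> U !=set0 -> lp_params (fun _ : U => A).
Proof.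
move=> oU U0; exists A; split=> //.
have sv : @smooth (@subSpace X (val A)) X val by [].
pose i : funSpace (@subSpace X (val A)) X := exist _ _ sv.
exists (fun=> i); split.
- by move=> m V P pP; exact/plot_cst/plot_open/pP.
- by case: U0 => r Ur; exists (SigSub (mem_set Ur)).
- move=> _ /=; rewrite eqEsubset; split=> [x Ax|x [a _ <-]].
    by exists (SigSub (mem_set Ax)).
  exact: set_mem (valP a).
Qed.

Definition Pstar_lp := generated lp_params_cst.

End PowerSet.

End Diffeology.

(* Main.v *)
Require Import Defs.
From mathcomp Require Import all_boot all_order all_algebra.
From mathcomp Require Import all_classical.
From mathcomp Require Import reals topology normedtype.

(** A generated diffeology is contained in every diffeology that contains its
    generators, so it suffices to treat a local projectable parametrization
    [phi r = range (varphi r)].  A point [x0] of [phi r0] is [varphi r0 a] for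
    some [a], and [r |-> varphi r a] is then a plot through [x0] that stays in
    [phi r]. *)

Set Implicit Arguments.
Unset Strict Implicit.
Unset Printing Implicit Defensive.

Local Open Scope classical_set_scope.

(** Locally [P] is a smooth reparametrization of a generator, so [plot_comp] followed by
    [plot_local] gives the claim. *)
Lemma generated_min (R : realType) (Y : diffSpace R)
    (G : forall n (U : set 'rV[R]_n), set (U -> Y)) n (U : set 'rV[R]_n)
    (P : U -> Y) :
  (forall m (W : set 'rV[R]_m) (Q : W -> Y), G m W Q -> plot Y Q) ->
  generated_plot G P -> plot Y P.
Proof.
move=> GY [oU H]; apply: plot_local => // r.
have [V [VU [Vr oV [m [W [Q [F [_ GQ sF PQ]]]]]]]] := H r.
exists V, VU; split=> //.
by rewrite (funext PQ); exact: plot_comp oV sF (GY _ _ _ GQ).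
Qed.

(** Testing [Q] against the constant plot [a] on [V] gives a plot on [prod_dom V V]; its pullback
    along the diagonal [H] is the evaluation at [a]. *)
Lemma plot_eval (R : realType) (A X : diffSpace R) n (V : set 'rV[R]_n)
    (Q : V -> funSpace A X) (a : A) :
  plot (funSpace A X) Q -> plot X (fun r => proj1_sig (Q r) a).
Proof.
move=> [oV /(_ _ _ _ (plot_cst a oV)) pQ].
have sid := smooth_map_incl (@subset_refl _ V).
have [H [sH H1 _]] := smooth_prod_pair sid sid.
have := plot_comp oV sH pQ; congr (plot X _).
rewrite funeqE => r /=; rewrite H1.
by congr (proj1_sig (Q _) a); exact: val_inj.
Qed.

Lemma local_projectable_plot_u (R : realType) (X : diffSpace R) (A : Pstar X) n
    (U : set 'rV[R]_n) (phi : U -> Pstar X) :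
  local_projectable A phi -> plot (Pstar_u X) phi.
Proof.
move=> [oU _ [varphi [svarphi _ phiE]]]; apply/union_plotP; split=> // r0 x0.
rewrite phiE => -[a _ ax0].
(* The identity of [U], written as a [set_incl], is a plot of [domain U]; smoothness of [varphi]
   applied to it makes [varphi] itself a plot. *)
have pid : plot (domain U) (set_incl (@subset_refl _ U)).
  by split=> //; exact: smooth_map_incl.
exists U, (@subset_refl _ U), (fun r => proj1_sig (varphi r) a); split.
- exact: set_mem (valP r0).
- have := plot_eval a (svarphi _ _ _ pid); congr (plot X _).
  rewrite funeqE => r /=; congr (proj1_sig (varphi _) a); exact: val_inj.
- move=> r; rewrite phiE; exists a => //.
  by congr (proj1_sig (varphi _) a); exact: val_inj.
- by move=> r rr0; rewrite -ax0; congr (proj1_sig (varphi _) a); exact: val_inj.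
Qed.

Theorem proposition5p2 (R : realType) (X : diffSpace R) :
  smooth (id : Pstar_lp X -> Pstar_u X) /\
  (forall (n : nat) (U : set 'rV[R]_n) (P : U -> Pstar X),
      plot (Pstar_lp X) P -> plot (Pstar_u X) P).
Proof.
have lp_u n (U : set 'rV[R]_n) (P : U -> Pstar X) :
    plot (Pstar_lp X) P -> plot (Pstar_u X) P.
  apply: (@generated_min _ (Pstar_u X)) => m W Q [A].
  exact: local_projectable_plot_u.
(* Since [id \o P] is convertible to [P], smoothness of [id] is this same inclusion. *)
by split=> // n U P; exact: lp_u.
Qed.
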